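(* Let $\lambda>0$ and let $\{c_k\}_{k\ge1}$ be i.i.d. random variables whose common distribution is absolutely continuous on $[0,1]$ with almost everywhere positive and uniformly bounded density. Let $l_k=e^{-\lambda k}$. Then, almost surely, assumptions (A1), (A2), (A3) below are satisfied.
   Context: Notation: $\mathcal{A}_n=\{n,\dots,2n-1\}$, $\mathcal{A}_{n,q}=\mathcal{A}_n\cup\mathcal{A}_{2n}\cup\cdots\cup\mathcal{A}_{2^qn}$. (A1) There is $\phi\in L^1([0,1],dx)$, $\phi>0$ a.e., with $\frac{1}{\#\mathcal{A}_n}\sum_{k\in\mathcal{A}_n}f(c_k)\to\int_0^1 f\phi\,dx$ for every $f\in C([0,1])$. There is a sequence of integers $q(n)\to\infty$ such that: (A2) for every $\varepsilon>0$ there is $\delta>0$ such that for all large $n$ and all $n',n''\in\{n,2n,\dots,2^{q(n)}n\}$, $\frac{1}{\#(\mathcal{A}_{n'}\times\mathcal{A}_{n''})}\sum_{i\in\mathcal{A}_{n'},j\in\mathcal{A}_{n''},\,i\neq j,\,|c_i-c_j|<\delta}(-\log|c_i-c_j|)<\varepsilon$; (A3) for every $\varepsilon>0$, for all large $n$ and all $i\ne j$ in $\mathcal{A}_{n,q(n)}$, $\frac{l_i+l_j}{2|c_i-c_j|}<\varepsilon$. *)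

(* Defs.v *)
From HB Require Import structures.
From mathcomp Require Import all_boot all_order all_algebra.
From mathcomp Require Import all_classical all_reals all_analysis.
Set Implicit Arguments. Unset Strict Implicit. Unset Printing Implicit Defensive.
Import Order.TTheory GRing.Theory Num.Theory.
Import numFieldNormedType.Exports.
Local Open Scope classical_set_scope.
Local Open Scope ring_scope.

Definition mutually_independent_rv (d : measure_display) (T : measurableType d)
    (R : realType) (P : probability T R) (I : set nat) (X : nat -> T -> R) :=
  forall (J : seq nat) (A : nat -> set R),
    uniq J -> (forall i, i \in J -> I i) ->
    (forall i, measurable (A i)) ->
    P (\bigcap_(i in [set i | i \in J]) (X i @^-1` A i)) =
      (\prod_(i <- J) P (X i @^-1` A i))%E.

(* A_n = {n, ..., 2n-1} ; membership in A_{n,q} = A_n U A_{2n} U ... U A_{2^q n} *)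
Definition in_Anq (n q i : nat) : Prop :=
  exists a : nat, (a <= q)%N /\ (2 ^ a * n <= i < 2 ^ a.+1 * n)%N.

Definition assumption_A1 (R : realType) (c : nat -> R) : Prop :=
  exists phi : R -> R,
    lebesgue_measure.-integrable (`[0%R, 1%R]%classic : set R) (EFin \o phi) /\
    {ae lebesgue_measure, forall x, (`[0%R, 1%R]%classic : set R) x -> 0 < phi x} /\
    forall f : R -> R, {within (`[0%R, 1%R]%classic : set R), continuous f} ->
      (fun n : nat => (n%:R)^-1 * \sum_(n <= k < n.*2) f (c k))
        @ \oo --> Rintegral lebesgue_measure (`[0%R, 1%R]%classic : set R) (fun x => f x * phi x).

Definition assumption_A2 (R : realType) (c : nat -> R) (q : nat -> nat) : Prop :=
  forall eps : R, 0 < eps ->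
  exists2 delta : R, 0 < delta &
  exists N : nat, forall n : nat, (N <= n)%N ->
  forall a b : nat, (a <= q n)%N -> (b <= q n)%N ->
    let n' := (2 ^ a * n)%N in let n'' := (2 ^ b * n)%N in
    ((n' * n'')%:R)^-1 *
      \sum_(n' <= i < n'.*2)
        \sum_(n'' <= j < n''.*2 | (i != j) && (`|c i - c j| < delta))
          (- ln `|c i - c j|) < eps.

(* (A3) for given sequences c, l, q.  The quotient is only meaningful for
   c_i <> c_j; we require this explicitly. *)
Definition assumption_A3 (R : realType) (c l : nat -> R) (q : nat -> nat) : Prop :=
  forall eps : R, 0 < eps ->
  exists N : nat, forall n : nat, (N <= n)%N ->
  forall i j : nat, in_Anq n (q n) i -> in_Anq n (q n) j -> i <> j ->
    c i <> c j /\ (l i + l j) / (2 * `|c i - c j|) < eps.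

Definition assumptions_A123 (R : realType) (c l : nat -> R) : Prop :=
  assumption_A1 c /\
  exists q : nat -> nat,
    (forall M : nat, exists N : nat, forall n, (N <= n)%N -> (M <= q n)%N) /\
    assumption_A2 c q /\ assumption_A3 c l q.

(* Main.v *)
Require Import Defs.
From HB Require Import structures.
From mathcomp Require Import all_boot all_order all_algebra.
From mathcomp Require Import all_classical all_reals all_analysis.
From mathcomp Require Import measurable_realfun.
From mathcomp Require Import zify ring lra.
Set Implicit Arguments. Unset Strict Implicit. Unset Printing Implicit Defensive.
Import Order.TTheory GRing.Theory Num.Theory.
Import numFieldNormedType.Exports.
Local Open Scope classical_set_scope.
Local Open Scope ring_scope.

(** Everything reduces to Borel-Cantelli with failure probabilities O(1/n^2).
    Expanding [(1 + t) ^ S], for [S] the number of points of a block falling in a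
    set, and using independence gives a Chernoff bound for [S].  Hence the
    frequency with which the block A_n visits a grid cell converges to the mass
    of the cell, and (A1) follows by approximating [f] by step functions.
    With [4 ^ q(n) <= n], the same bound shows that for all blocks and all
    dyadic grids of mesh [2 ^ -m], [m <= q(n)], no cell contains more than four
    times its expected share of points, so the fraction of pairs at distance
    below [2 ^ -m] is O([2 ^ -m]).  Covering by a grid of mesh [n ^ -5] shows that
    all points of A_{n,q(n)} are [n ^ -5]-separated, which gives (A3) because
    [l_k] decays exponentially, and which caps [- ln |c_i - c_j|] by [10 (q(n) + 1)].
    Hence [- ln |c_i - c_j|] is dominated by a sum over [m <= q(n)] of [10 (m + 1)]
    times the indicator of [|c_i - c_j| < 2 ^ -m], and (A2) follows since the tails
    of the series of [(m + 1) / 2 ^ m] tend to 0. *)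

(** * Borel-Cantelli for failure probabilities bounded by [C / n^2] *)

Lemma sum_inv_sqr_le2 (R : realFieldType) (n : nat) :
  \sum_(0 <= i < n) (i.+1%:R ^- 2 : R) <= 2.
Proof.
case: n => [|n]; first by rewrite big_geq.
(* The sharper bound is inductive, because [1/x - 1/(x+1) - 1/(x+1)^2 = 1/(x (x+1)^2)] is
   nonnegative. *)
suff: \sum_(0 <= i < n.+1) (i.+1%:R ^- 2 : R) <= 2 - n.+1%:R^-1.
  by move/le_trans; apply; rewrite gerBl invr_ge0.
elim: n => [|n ih]; first by rewrite big_nat1; lra.
rewrite big_nat_recr//= (le_trans (lerD ih (lexx _)))//.
have n0 : 0 < n.+1%:R :> R by [].
have -> : n.+2%:R = n.+1%:R + 1 :> R by rewrite -natr1.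
move: (n.+1%:R : R) n0 => x x0.
rewrite -subr_ge0 [leRHS](_ : _ = x^-1 * (x + 1) ^- 2).
  by rewrite mulr_ge0// invr_ge0 ?exprn_ge0// ltW// ltr_wpDr.
by field; rewrite !gt_eqF// ltr_wpDr.
Qed.

Lemma borel_cantelli_inv_sqr (R : realType) (d : measure_display)
    (T : measurableType d) (P : probability T R) (F : nat -> set T) (C : R) :
  (forall n, (0 < n)%N -> measurable (F n)) ->
  (forall n, (0 < n)%N -> (P (F n) <= (C / n%:R ^+ 2)%:E)%E) ->
  {ae P, forall w, exists N, forall n, (N <= n)%N -> ~ F n w}.
Proof.
(* Events are shifted by one index, since the hypotheses speak of [n > 0] only. *)
move=> mF PF; have mF1 n : measurable (F n.+1) by exact: mF.
have C0 : 0 <= C.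
  by have := le_trans (measure_ge0 P (F 1%N)) (PF 1%N isT);
    rewrite lee_fin expr1n divr1.
have sumF : (\sum_(n <oo) P (F n.+1) < +oo)%E.
  apply: (@le_lt_trans _ _ (C * 2)%:E); last exact: ltry.
  apply: lime_le; first exact: is_cvg_nneseries.
  apply: nearW => n; apply: (@le_trans _ _ (\sum_(0 <= i < n) (C * i.+1%:R ^- 2)%:E)%E).
    by apply: lee_sum => i _; exact: PF.
  by rewrite sumEFin lee_fin -big_distrr/= ler_wpM2l// sum_inv_sqr_le2.
exists (lim_sup_set (fun n => F n.+1)); split.
- by apply: bigcap_measurable => // n _; apply: bigcup_measurable => k _.
- exact: lim_sup_set_cvg0.
- move=> w /= H n _; apply: contra_notP H => Fnw; exists n.+1 => -[//|m nm Fm].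
  by apply: Fnw; exists m.
Qed.

(** * Exponential moments and a Chernoff bound for independent events *)

Section independent_events.
Context (R : realType) (d : measure_display) (T : measurableType d)
  (P : probability T R) (c : nat -> T -> R) (A : nat -> set R) (p : R).
Hypothesis mc : forall k, (0 < k)%N -> measurable_fun setT (c k).
Hypothesis ind : mutually_independent_rv P [set k | (0 < k)%N] c.
Hypothesis mA : forall k, measurable (A k).
Hypothesis pA : forall k, (0 < k)%N -> (P (c k @^-1` A k) <= p%:E)%E.

Definition hits (J : seq nat) (w : T) : nat := count (fun k => c k w \in A k) J.

Lemma measurable_hit (k : nat) : (0 < k)%N -> measurable (c k @^-1` A k).
Proof. by move=> k0; rewrite -[X in measurable X]setTI; exact: mc. Qed.

Lemma measurable_all_hits (I : seq nat) : all (ltn 0) I ->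
  measurable (\bigcap_(k in [set k | k \in I]) c k @^-1` A k).
Proof.
move=> /allP I0; apply: fin_bigcap_measurable => [|k /= /I0].
  exact: finite_seq.
exact: measurable_hit.
Qed.

Let indic_hit (k : nat) (w : T) :
  \1_(c k @^-1` A k) w = (c k w \in A k)%:R :> R.
Proof. by rewrite indicE. Qed.

Let hit_prob_ge0 : 0 <= p.
Proof. by rewrite -lee_fin (le_trans _ (@pA 1%N isT))// measure_ge0. Qed.

Lemma measurable_pow_hits (t : R) (J : seq nat) : all (ltn 0) J ->
  measurable_fun setT (fun w => (1 + t) ^+ hits J w).
Proof.
move=> /allP J0.
rewrite (_ : (fun _ => _) =
  (fun w => \prod_(k <- J) (1 + t * \1_(c k @^-1` A k) w))); last first.
  apply/funext => w; rewrite /hits; elim: J {J0} => [|k J ih].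
    by rewrite big_nil.
  rewrite big_cons -ih /= exprD indic_hit; congr (_ * _).
  by case: (_ \in _); rewrite ?mulr1 ?mulr0 ?addr0 ?expr1 ?expr0.
apply: measurable_prod => k /J0 k0; apply: measurable_funD => //.
by apply: measurable_funM => //; apply: measurable_indic; exact: measurable_hit.
Qed.

(* [I] collects the indices already chosen when the product
   [\prod_(k <- J) (1 + t 1_{A k})] is expanded, which makes the statement
   inductive in [J]. *)
Lemma expectation_pow_hits (t : R) (I J : seq nat) : 0 <= t ->
  uniq (I ++ J) -> all (ltn 0) (I ++ J) ->
  (\int[P]_w (\1_(\bigcap_(k in [set k | k \in I]) c k @^-1` A k) w *
     (1 + t) ^+ hits J w)%:E <= (p ^+ size I * (1 + t * p) ^+ size J)%:E)%E.
Proof.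
move=> t0; elim: J I => [|j J ih] I; rewrite ?cats0 => uI I0.
  rewrite [(1 + t * p) ^+ _]expr0 mulr1.
  under eq_integral do rewrite [(1 + t) ^+ _]expr0 mulr1.
  rewrite integral_indic//; last exact: measurable_all_hits.
  (* With nothing left to expand, independence factors the probability of the intersection, and each
     factor is at most [p]. *)
  rewrite setIT [leLHS](ind uI _ mA); last by move=> i; exact: (allP I0).
  elim: I I0 {uI} => [|i I ihI]/=; first by rewrite big_nil expr0.
  move=> /andP[i0 I0]; rewrite big_cons exprS EFinM lee_pmul//.
  - by apply: prode_ge0.
  - exact: pA.
  - exact: ihI.
have [uI' I0'] : uniq (I ++ J) /\ all (ltn 0) (I ++ J).
  move: uI I0; rewrite -cat1s uniq_catCA cat1s /= => /andP[_ ->].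
  by rewrite !all_cat /= => /and3P[-> _ ->].
have [uj j0] : uniq ((j :: I) ++ J) /\ all (ltn 0) ((j :: I) ++ J).
  move: uI I0; rewrite -cat1s uniq_catCA => ->.
  by rewrite /= !all_cat/= => /and3P[-> -> ->].
have mE (L : seq nat) : all (ltn 0) (L ++ J) -> measurable_fun setT
    (fun w => (\1_(\bigcap_(k in [set k | k \in L]) c k @^-1` A k) w *
     (1 + t) ^+ hits J w)).
  rewrite all_cat => /andP[L0 J0]; apply: measurable_funM.
    by apply: measurable_indic; exact: measurable_all_hits.
  exact: measurable_pow_hits.
have E0 (L : seq nat) w : 0 <= \1_(\bigcap_(k in [set k | k \in L]) c k @^-1` A k) w *
     (1 + t) ^+ hits J w.
  by rewrite mulr_ge0// exprn_ge0// addr_ge0.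
(* The factor of index [j] is [1 + t 1_{A j}]. Its first term leaves [I] unchanged, its second moves
   [j] into [I]; the induction hypothesis applies to both. *)
under eq_integral => w _.
  rewrite (_ : (_ * _) =
    \1_(\bigcap_(k in [set k | k \in I]) c k @^-1` A k) w * (1 + t) ^+ hits J w +
    t * (\1_(\bigcap_(k in [set k | k \in j :: I]) c k @^-1` A k) w *
         (1 + t) ^+ hits J w)); last first.
    have -> : \bigcap_(k in [set k | k \in j :: I]) c k @^-1` A k =
        (c j @^-1` A j) `&` \bigcap_(k in [set k | k \in I]) c k @^-1` A k.
      by rewrite !bigcap_seq big_cons.
    rewrite indicI /= [in LHS]/hits /= -/(hits J w) exprD.
    rewrite indic_hit.
    by case: (_ \in _) => /=; rewrite ?expr1 ?expr0; ring.
  rewrite EFinD; over.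
rewrite ge0_integralD//=; first last.
- by apply/measurable_EFinP; apply: measurable_funM => //; exact: mE.
- by move=> w _; rewrite lee_fin mulr_ge0.
- by apply/measurable_EFinP; exact: mE.
- by move=> w _; rewrite lee_fin.
under [X in (_ + X)%E]eq_integral do rewrite EFinM.
rewrite ge0_integralZl//; first last.
- by move=> w _; rewrite lee_fin.
- by apply/measurable_EFinP; exact: mE.
apply: (@le_trans _ _ ((p ^+ size I * (1 + t * p) ^+ size J)%:E +
    t%:E * (p ^+ (size I).+1 * (1 + t * p) ^+ size J)%:E)%E).
  by apply: leeD; [exact: ih|apply: lee_wpmul2l => //; exact: (ih (j :: I))].
by rewrite -EFinM -EFinD lee_fin !exprS le_eqVlt; apply/predU1P; left; ring.
Qed.

(** The threshold is kept general because a hit at the first index lowers it by one. *)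
Lemma measurable_hits_ge (J : seq nat) (s : R) : all (ltn 0) J ->
  measurable [set w | s <= (hits J w)%:R].
Proof.
elim: J s => [|j J ih] s /=.
  by move=> _; case: (boolP (s <= 0)) => s0;
    rewrite (_ : [set _ | _] = if s <= 0 then setT else set0) ?s0 ?(negbTE s0)//;
    apply/seteqP; split=> w //=; rewrite /hits/= (negbTE s0).
move=> /andP[j0 J0].
have -> : [set w | s <= (hits (j :: J) w)%:R] =
    (c j @^-1` A j `&` [set w | s - 1 <= (hits J w)%:R]) `|`
    [set w | s <= (hits J w)%:R].
  apply/seteqP; split=> w; rewrite /= /hits /= natrD -/(hits J w).
    case: (boolP (c j w \in A j)) => [/set_mem cA h|_]; last by rewrite add0r; right.
    by left; split => //; rewrite lerBlDl.
  move=> [[/mem_set -> ]|]; first by rewrite lerBlDl.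
  by move=> h; rewrite (le_trans h)// lerDr.
apply: measurableU; last exact: ih.
by apply: measurableI; [exact: measurable_hit|exact: ih].
Qed.

(** Markov's inequality for [(1 + t) ^ S], where [S] is the number of hits. The mean is at most
    [(1 + t p) ^ size J], hence at most [exp (t p size J)], and [ln (1 + t)] is replaced by its
    rational lower bound [t / (1 + t)]. *)
Lemma chernoff_hits (t s : R) (J : seq nat) : 0 < t ->
  uniq J -> all (ltn 0) J ->
  (P [set w | (s <= (hits J w)%:R)%R] <=
     (expR (t * p * (size J)%:R - s * (t / (1 + t)))%R)%:E)%E.
Proof.
move=> t0 uJ J0; have t1 : 0 < 1 + t by rewrite addr_gt0.
set B := [set w | _]; have mB : measurable B by exact: measurable_hits_ge.
have h1 : 0 < 1 + t * p by rewrite ltr_pwDl// mulr_ge0// ltW.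
(* After inversion this is [1 - u <= exp (- u)] at [u = t / (1 + t)], as [1 - u = 1 / (1 + t)]. *)
have exp1t : expR (t / (1 + t)) <= 1 + t.
  rewrite -[leRHS]invrK -[leLHS]invrK -expRN lef_pV2 ?posrE ?expR_gt0 ?invr_gt0//.
  rewrite (le_trans _ (expR_ge1Dx _))// le_eqVlt; apply/predU1P; left.
  by field; lra.
have : ((expR (s * (t / (1 + t))))%:E * P B <=
        (expR (t * p * (size J)%:R))%:E)%E.
  rewrite -[B]setIT -integral_indic// -ge0_integralZl//; first last.
  - by apply/measurable_EFinP; exact: measurable_indic.
  apply: (@le_trans _ _ (\int[P]_w ((1 + t) ^+ hits J w)%:E)%E).
    apply: ge0_le_integral => //.
    - by apply: measurable_funeM; apply/measurable_EFinP; exact: measurable_indic.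
    - by apply/measurable_EFinP; exact: measurable_pow_hits.
    - move=> w _; rewrite -EFinM lee_fin indicE.
      case: (boolP (w \in B)) => [/set_mem/= Bw|_]; last first.
        by rewrite mulr0 exprn_ge0// ltW.
      rewrite mulr1 (@le_trans _ _ (expR (t / (1 + t)) ^+ hits J w))//.
        rewrite -expRM_natl ler_expR ler_wpM2r// divr_ge0 ?ltW//.
      by rewrite lerXn2r ?nnegrE ?expR_ge0// ltW.
  have := @expectation_pow_hits t [::] J (ltW t0) uJ J0.
  rewrite [size [::]]/= expr0 mul1r.
  rewrite (_ : \bigcap_(_ in _) _ = setT); last by apply/seteqP; split.
  under eq_integral do rewrite indicT mul1r.
  move=> /le_trans; apply; rewrite lee_fin expRM_natr.
  by rewrite lerXn2r ?nnegrE ?expR_ge0 ?expR_ge1Dx// ltW.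
rewrite expRD expRN -lee_pdivlMl ?expR_gt0// => /le_trans; apply.
by rewrite -EFinM lee_fin mulrC.
Qed.

End independent_events.

(** * Polynomial decay of exponentials and finite union bounds *)

Lemma expRN_le (R : realType) (x : R) (k : nat) : 0 < x ->
  expR (- x) <= k.+1`!%:R / x ^+ k.+1.
Proof.
move=> x0; have f0 : 0 < k.+1`!%:R :> R by rewrite ltr0n fact_gt0.
have y0 : 0 < x ^+ k.+1 / k.+1`!%:R by rewrite divr_gt0// exprn_gt0.
(* After inversion it is enough to keep one term of the exponential series. This turns Chernoff
   bounds into the powers of [1 / n] wanted by Borel-Cantelli. *)
rewrite -invf_div expRN lef_pV2 ?posrE ?expR_gt0//.
by rewrite (le_trans _ (expR_ge1Dxn k (ltW x0)))// lerDr.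
Qed.

Lemma all_pos_block (m n : nat) : (0 < m)%N -> all (ltn 0) (index_iota m n).
Proof.
by move=> m0; apply/allP => k; rewrite mem_index_iota => /andP[/(leq_trans m0)].
Qed.

Lemma measurable_bigcup_seq (d : measure_display) (T : measurableType d)
    (I : choiceType) (s : seq I) (E : I -> set T) :
  (forall x, x \in s -> measurable (E x)) ->
  measurable (\bigcup_(x in [set` s]) E x).
Proof. by move=> mE; apply: fin_bigcup_measurable => //; exact: finite_seq. Qed.

Lemma finite_union_bound (d : measure_display) (T : measurableType d)
    (R : realType) (P : probability T R) (I : choiceType) (s : seq I)
    (E : I -> set T) (b : R) :
  (forall x, x \in s -> measurable (E x)) ->
  (forall x, x \in s -> (P (E x) <= b%:E)%E) ->
  (P (\bigcup_(x in [set` s]) E x) <= ((size s)%:R * b)%:E)%E.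
Proof.
move=> mE PE; rewrite bigcup_seq.
elim: s mE PE => [|x s ih] mE PE; first by rewrite big_nil measure0 mul0r.
rewrite big_cons (le_trans (measureU2 _ _ _))//.
- by apply: mE; rewrite mem_head.
- rewrite -bigcup_seq; apply: measurable_bigcup_seq => y ys.
  by apply: mE; rewrite in_cons ys orbT.
- rewrite [size _]/= -add1n natrD mulrDl mul1r EFinD leeD//.
    by apply: PE; rewrite mem_head.
  by apply: ih => y ys; [apply: mE|apply: PE]; rewrite in_cons ys orbT.
Qed.

(** * Convergence of the block frequencies of a fixed set *)

Section iid_blocks.
Context (R : realType) (d : measure_display) (T : measurableType d)
  (P : probability T R) (c : nat -> T -> R).
Hypothesis mc : forall k, (0 < k)%N -> measurable_fun setT (c k).
Hypothesis ind : mutually_independent_rv P [set k | (0 < k)%N] c.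

Lemma ae_hits_block_lt (A : set R) (p eps : R) : measurable A ->
  (forall k, (0 < k)%N -> P (c k @^-1` A) = p%:E) -> 0 < eps ->
  {ae P, forall w, exists N, forall n, (N <= n)%N ->
    (hits c (fun=> A) (index_iota n n.*2) w)%:R < n%:R * (p + eps)}.
Proof.
move=> mA pA eps0.
have p1 : p <= 1.
  by rewrite -lee_fin -(pA 1%N isT) probability_le1//; exact: measurable_hit.
(* With [eps = 2 t] the Chernoff exponent is [- n t^2 (2 - p) / (1 + t)], which is at most [- n x]
   because [p <= 1]. *)
pose t := eps / 2; have t0 : 0 < t by rewrite divr_gt0.
pose x := t ^+ 2 / (1 + t).
have x0 : 0 < x by rewrite divr_gt0 ?exprn_gt0 ?addr_gt0.
pose F n := [set w | n%:R * (p + eps) <=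
  (hits c (fun=> A) (index_iota n n.*2) w)%:R].
have PF n : (0 < n)%N -> (P (F n) <= (2 / x ^+ 2 / n%:R ^+ 2)%:E)%E.
  move=> n0; have nR : 0 < n%:R :> R by rewrite ltr0n.
  apply: le_trans (@chernoff_hits _ _ _ _ _ (fun=> A) p mc ind _ _ t _ _ t0 _ _) _ => //.
  - by move=> k k0; rewrite pA.
  - exact: iota_uniq.
  - exact: all_pos_block.
  rewrite lee_fin size_iota -addnn addnK.
  have := expRN_le 1 (mulr_gt0 x0 nR).
  rewrite (_ : 2`! = 2%N)// exprMn invfM [2 * (_ / _)]mulrA.
  move=> /(le_trans _); apply; rewrite ler_expR -subr_ge0.
  rewrite [leRHS](_ : _ = t ^+ 2 * n%:R * (1 - p) / (1 + t)).
    by rewrite divr_ge0 ?addr_ge0 ?mulr_ge0 ?exprn_ge0 ?subr_ge0// ltW.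
  by rewrite /x (_ : eps = 2 * t); [field; lra|rewrite /t; lra].
have mF n : (0 < n)%N -> measurable (F n).
  by move=> n0; apply: measurable_hits_ge => //; exact: all_pos_block.
apply: filterS (borel_cantelli_inv_sqr mF PF) => w [N FN].
by exists N => n /FN /negP; rewrite -ltNge.
Qed.

(** Upper deviations suffice: a lower deviation for [A] is an upper one for its complement.
    Tolerances [1 / (i + 1)] keep the number of exceptional null sets countable. *)
Lemma ae_block_frequency_cvg (A : set R) (p : R) : measurable A ->
  (forall k, (0 < k)%N -> P (c k @^-1` A) = p%:E) ->
  {ae P, forall w,
    (hits c (fun=> A) (index_iota n n.*2) w)%:R / n%:R @[n --> \oo] --> p}.
Proof.
move=> mA pA; have mAC : measurable (~` A) by exact: measurableC.
have pAC k : (0 < k)%N -> P (c k @^-1` (~` A)) = (1 - p)%:E.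
  move=> k0; rewrite preimage_setC probability_setC ?pA//.
  exact: (@measurable_hit _ _ _ _ (fun=> A) mc (fun=> mA)).
have : {ae P, forall w, forall i : nat,
    (exists N, forall n, (N <= n)%N ->
       (hits c (fun=> A) (index_iota n n.*2) w)%:R < n%:R * (p + i.+1%:R^-1)) /\
    (exists N, forall n, (N <= n)%N ->
       (hits c (fun=> ~` A) (index_iota n n.*2) w)%:R < n%:R * (1 - p + i.+1%:R^-1))}.
  apply: ae_foralln => i.
  have i0 : 0 < i.+1%:R^-1 :> R by rewrite invr_gt0.
  by apply: filterS2 (ae_hits_block_lt mA pA i0) (ae_hits_block_lt mAC pAC i0).
apply: filterS => w wA; apply/cvgrPdist_lt => e e0.
have [i ie] : exists i : nat, i.+1%:R^-1 < e.
  exists (Num.truncn e^-1); rewrite invf_plt ?posrE//; exact: truncnS_gt.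
have [[N1 HN1] [N2 HN2]] := wA i.
near=> n.
have n0 : (0 < n)%N by near: n; exists 1%N.
have nR : 0 < n%:R :> R by rewrite ltr0n.
have {HN1} h1 : (hits c (fun=> A) (index_iota n n.*2) w)%:R < n%:R * (p + i.+1%:R^-1).
  by apply: HN1; near: n; exists N1.
have {HN2} : (hits c (fun=> ~` A) (index_iota n n.*2) w)%:R < n%:R * (1 - p + i.+1%:R^-1).
  by apply: HN2; near: n; exists N2.
have -> : hits c (fun=> ~` A) (index_iota n n.*2) w =
    (n - hits c (fun=> A) (index_iota n n.*2) w)%N.
  rewrite -[X in (X - _)%N](_ : size (index_iota n n.*2) = n); last first.
    by rewrite size_iota -addnn addnK.
  rewrite -(count_predC (fun k => c k w \in A)) addKn; apply: eq_count => k /=.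
  by rewrite in_setC.
have hn : (hits c (fun=> A) (index_iota n n.*2) w <= n)%N.
  by rewrite (leq_trans (count_size _ _))// size_iota -addnn addnK.
rewrite natrB// => h2.
rewrite distrC ltr_norml ltrBrDr ltr_pdivlMr// ltrBlDr ltr_pdivrMr//.
move: (hits _ _ _ _)%:R (i.+1%:R^-1) (n%:R) ie nR h1 h2 => H u r ue r0 h1 h2.
by apply/andP; split; nra.
Unshelve. all: by end_near. Qed.

End iid_blocks.

(** * Grid cells of mesh [1 / K] *)

Definition cell (R : realType) (K j : nat) : set R :=
  [set` `[j%:R / K%:R, j.+1%:R / K%:R[].

Section cells.
Context (R : realType).
Implicit Types (x y : R) (K : nat).

(** Cells are half-open so that the cell of a point is unique and given by an integer part. The
    point 1 lies in cell [K], so [[0,1]] meets [K + 1] cells. *)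
Lemma cell_trunc K x : (0 < K)%N -> 0 <= x -> cell K (Num.truncn (K%:R * x)) x.
Proof.
move=> K0 x0; have KR : 0 < K%:R :> R by rewrite ltr0n.
have Kx0 : 0 <= K%:R * x by rewrite mulr_ge0// ltW.
rewrite /cell/= in_itv/= ler_pdivrMr// ltr_pdivlMr// [x * _]mulrC.
by rewrite truncn_le Kx0 truncnS_gt.
Qed.

Lemma trunc_cell K j x : (0 < K)%N -> cell K j x -> Num.truncn (K%:R * x) = j.
Proof.
move=> K0; have KR : 0 < K%:R :> R by rewrite ltr0n.
rewrite /cell/= in_itv/= ler_pdivrMr// ltr_pdivlMr// [x * _]mulrC => xj.
exact: truncn_def.
Qed.

Lemma trunc_le K x : 0 <= x <= 1 -> (Num.truncn (K%:R * x) <= K)%N.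
Proof.
move=> /andP[x0 x1]; rewrite truncn_le_nat (@le_lt_trans _ _ K%:R) ?ltr_nat//.
by rewrite ler_piMr.
Qed.

(** After scaling by [K] the distance is below 1, so the integer parts differ by at most one. For
    [a = 0] the truncated predecessor only repeats [a]. *)
Lemma trunc_near K x y : (0 < K)%N -> 0 <= x -> 0 <= y -> `|x - y| < K%:R^-1 ->
  Num.truncn (K%:R * y) \in
    let a := Num.truncn (K%:R * x) in [:: a.-1; a; a.+1].
Proof.
move=> K0 x0 y0 xy; have KR : 0 < K%:R :> R by rewrite ltr0n.
have H (u v : R) : 0 <= v -> `|u - v| < K%:R^-1 ->
    (Num.truncn (K%:R * v) <= (Num.truncn (K%:R * u)).+1)%N.
  move=> v0 uv; rewrite truncn_le_nat -natr1.
  have := truncnS_gt (K%:R * u).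
  have : `|K%:R * u - K%:R * v| < 1.
    by rewrite -mulrBr normrM gtr0_norm// -ltr_pdivlMl// mulr1.
  rewrite ltr_norml => /andP[h1 h2] h3; lra.
have h1 := H x y y0 xy; have := H y x x0; rewrite distrC => /(_ xy) h2.
rewrite !inE; lia.
Qed.

Lemma measurable_cell K j : measurable (@cell R K j).
Proof. exact: measurable_itv. Qed.

Lemma lebesgue_measure_cell K j : (0 < K)%N ->
  lebesgue_measure (@cell R K j) = (K%:R^-1)%:E.
Proof.
move=> K0; have KR : 0 < K%:R :> R by rewrite ltr0n.
rewrite /cell lebesgue_measure_itv/= lte_fin ltr_pM2r ?invr_gt0// ltr_nat leqnn.
by rewrite -EFinB -mulrBl -natr1 addrAC subrr add0r mul1r.
Qed.

End cells.

(* This will serve as [q n]; [4 ^ scales n <= n] for [n > 0]. *)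
Definition scales (n : nat) : nat := trunc_log 4 n.

Lemma expn4E (h : nat) : (4 ^ h = (2 ^ h) ^ 2)%N.
Proof. by rewrite -expnM mulnC expnM. Qed.

(** Together with [lt_scales], this puts [2 ^ scales n] between [sqrt n / 2] and [sqrt n]. The upper
    side keeps many points in each cell; the lower side makes decay in [2 ^ scales n] decay in
    [n]. *)
Lemma scales_le (n : nat) : (0 < n)%N -> ((2 ^ scales n) ^ 2 <= n)%N.
Proof. by move=> n0; rewrite -expn4E trunc_logP. Qed.

Lemma lt_scales (n : nat) : (n < 4 * (2 ^ scales n) ^ 2)%N.
Proof. by rewrite -expn4E -expnS trunc_log_ltn. Qed.

Lemma scales_unbounded (M : nat) :
  exists N, forall n, (N <= n)%N -> (M <= scales n)%N.
Proof.
exists (4 ^ M)%N => n Nn.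
by have := leq_trunc_log 4 Nn; rewrite /scales trunc_expnK.
Qed.

(** * Almost sure separation and cell counts under a bounded density *)

Section bounded_density.
Context (R : realType) (d : measure_display) (T : measurableType d)
  (P : probability T R) (c : nat -> T -> R) (M : R).
Hypothesis mc : forall k, (0 < k)%N -> measurable_fun setT (c k).
Hypothesis ind : mutually_independent_rv P [set k | (0 < k)%N] c.
Hypothesis M1 : 1 <= M.
Hypothesis cM : forall k, (0 < k)%N -> forall A : set R, measurable A ->
  (P (c k @^-1` A) <= M%:E * lebesgue_measure A)%E.

Let mpre k (A : set R) : (0 < k)%N -> measurable A -> measurable (c k @^-1` A).
Proof. by move=> k0 mA; rewrite -[X in measurable X]setTI; exact: mc. Qed.

Lemma prob_cell_le K j k : (0 < k)%N -> (0 < K)%N ->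
  (P (c k @^-1` cell K j) <= (M / K%:R)%:E)%E.
Proof.
move=> k0 K0; rewrite (le_trans (cM k0 (measurable_cell K j)))//.
by rewrite lebesgue_measure_cell.
Qed.

Lemma prob_cell_pair_le K (i j a b : nat) : (0 < i)%N -> (0 < j)%N -> i != j ->
  (0 < K)%N ->
  (P (c i @^-1` cell K a `&` c j @^-1` cell K b) <= ((M / K%:R) ^+ 2)%:E)%E.
Proof.
move=> i0 j0 ij K0.
(* One family of sets carries both cells, as the independence hypothesis requires. *)
pose A k : set R := if k == i then cell K a else cell K b.
have := @ind [:: i; j] A; rewrite bigcap_seq !big_cons !big_nil setIT mule1.
rewrite /A eqxx eq_sym (negbTE ij) => ->.
- by rewrite expr2 EFinM lee_pmul// prob_cell_le.
- by rewrite /= inE ij.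
- by move=> k; rewrite !inE => /orP[]/eqP->.
- by move=> k; case: ifP => _; exact: measurable_cell.
Qed.

(** Letting [e] run over 0, 1, 2 enumerates the three neighbouring cells of [trunc_near]. *)
Let offset (a e : nat) : nat := (a + e).-1.

(** Close points share a cell of mesh [n ^ -5] or lie in adjacent ones. There are at most [4 n^3]
    index pairs, [n^5 + 1] cells and 3 neighbours, each case having probability at most
    [M^2 / n^10]; the total is [24 M^2 / n^2]. The exponent 5 is the least that yields [n ^ -2]
    here. *)
Lemma ae_separated :
  {ae P, forall w, (forall k, (0 < k)%N -> 0 <= c k w <= 1)} ->
  {ae P, forall w, exists N, forall n, (N <= n)%N -> forall i j,
    (n <= i < 2 ^ (scales n).+1 * n)%N -> (n <= j < 2 ^ (scales n).+1 * n)%N ->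
    i != j -> n%:R ^- 5 <= `|c i w - c j w|}.
Proof.
move=> c01; pose s n := index_iota n (2 ^ (scales n).+1 * n).
(* The unions run over all pairs, so the diagonal is emptied: independence says nothing about
   [i = j]. *)
pose G n i j a e : set T := if i == j then set0 else
  c i @^-1` cell (n ^ 5) a `&` c j @^-1` cell (n ^ 5) (offset a e).
pose F n := \bigcup_(i in [set` s n]) \bigcup_(j in [set` s n])
  \bigcup_(a in [set` iota 0 (n ^ 5).+1]) \bigcup_(e in [set` iota 0 3]) G n i j a e.
have pos_s n i : (0 < n)%N -> i \in s n -> (0 < i)%N.
  by move=> n0; rewrite mem_index_iota => /andP[/(leq_trans n0)].
have mG n i j a e : (0 < n)%N -> i \in s n -> j \in s n -> measurable (G n i j a e).
  move=> n0 /(pos_s _ _ n0) i0 /(pos_s _ _ n0) j0; rewrite /G; case: ifP => // _.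
  by apply: measurableI; apply: mpre => //; exact: measurable_cell.
have mF n : (0 < n)%N -> measurable (F n).
  by move=> n0; do 4!(apply: measurable_bigcup_seq => ? ?); exact: mG.
have PF n : (0 < n)%N -> (P (F n) <= (24 * M ^+ 2 / n%:R ^+ 2)%:E)%E.
  move=> n0; have K0 : (0 < n ^ 5)%N by rewrite expn_gt0 n0.
  have szs : ((size (s n)) ^ 2 <= 4 * n ^ 3)%N.
    apply: (@leq_trans ((2 ^ (scales n).+1 * n) ^ 2)).
      by rewrite leq_exp2r// size_iota leq_subr.
    rewrite (expnS 2) -[(2 * _ * n)%N]mulnA expnMn leq_mul2l/= expnMn (expnS n 2).
    by rewrite leq_mul2r scales_le// orbT.
  apply: (@le_trans _ _ ((size (s n))%:R * ((size (s n))%:R *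
      ((size (iota 0 (n ^ 5).+1))%:R * ((size (iota 0 3))%:R *
        (M / (n ^ 5)%:R) ^+ 2))))%:E).
    apply: finite_union_bound => i ii.
      by do 3!(apply: measurable_bigcup_seq => ? ?); exact: mG.
    apply: finite_union_bound => j jj.
      by do 2!(apply: measurable_bigcup_seq => ? ?); exact: mG.
    apply: finite_union_bound => a _.
      by apply: measurable_bigcup_seq => e _; exact: mG.
    apply: finite_union_bound => e _; first exact: mG.
    rewrite /G; case: ifPn => ij.
      by rewrite measure0 lee_fin exprn_ge0// divr_ge0// (le_trans _ M1).
    by apply: prob_cell_pair_le => //; exact: pos_s n0 _.
  rewrite lee_fin !size_iota -(ler_nat R) in szs *.
  have nR : 1 <= n%:R :> R by rewrite ler1n.
  move: szs; rewrite -natr1 !natrX natrM natrX.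
  move: (_ - _)%N%:R => S; move: (n%:R : R) nR => x x1 Sx.
  have x0 : 0 < x by exact: lt_le_trans x1.
  rewrite (_ : S * _ = S ^+ 2 * ((x ^+ 5 + 1) * 3 * M ^+ 2 / x ^+ 10)); last first.
    by field; rewrite gt_eqF.
  apply: (@le_trans _ _ ((4 * x ^+ 3) * ((x ^+ 5 + x ^+ 5) * 3 * M ^+ 2 / x ^+ 10))).
    apply: ler_pM => //.
    - by rewrite sqr_ge0.
    - rewrite !mulr_ge0 ?invr_ge0 ?exprn_ge0 ?addr_ge0 ?exprn_ge0//;
        by rewrite ?(le_trans _ M1)// ltW.
    - rewrite !ler_wpM2r ?invr_ge0 ?exprn_ge0 ?(le_trans _ M1)// ?(ltW x0)//.
      by rewrite lerD2l exprn_ege1.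
  by rewrite le_eqVlt; apply/predU1P; left; field; rewrite gt_eqF.
have := borel_cantelli_inv_sqr mF PF; apply: filterS2 c01 => w w01 [N FN].
exists N.+1 => n Nn i j ni nj ij; have n0 : (0 < n)%N by exact: leq_trans Nn.
have K0 : (0 < n ^ 5)%N by rewrite expn_gt0 n0.
have i0 : (0 < i)%N by move: ni => /andP[/(leq_trans n0)].
have j0 : (0 < j)%N by move: nj => /andP[/(leq_trans n0)].
have /andP[ci0 ci1] := w01 _ i0; have /andP[cj0 cj1] := w01 _ j0.
rewrite leNgt; apply/negP => cij; apply: (FN n (ltnW Nn)).
pose a := Num.truncn ((n ^ 5)%:R * c i w).
have [e e3 eb] : exists2 e, (e < 3)%N & offset a e = Num.truncn ((n ^ 5)%:R * c j w).
  have := trunc_near K0 ci0 cj0; rewrite natrX => /(_ cij).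
  rewrite /= !inE -natrX -/a => /or3P[]/eqP ->.
  - by exists 0%N; rewrite // /offset addn0.
  - by exists 1%N; rewrite // /offset addn1.
  - by exists 2%N; rewrite // /offset addn2.
have aK : a \in iota 0 (n ^ 5).+1 by rewrite mem_iota add0n ltnS trunc_le// ci0.
have ek : e \in iota 0 3 by rewrite mem_iota.
exists i; first by rewrite /= mem_index_iota.
exists j; first by rewrite /= mem_index_iota.
exists a => //; exists e => //.
by rewrite /G (negbTE ij); split; rewrite /= ?eb; exact: cell_trunc.
Qed.

(** The index [j] goes one past the cell of the point 1, because the neighbours of occupied cells
    are counted later. *)
Lemma ae_cell_counts :
  {ae P, forall w, exists N, forall n, (N <= n)%N -> forall a m j,
    (a <= scales n)%N -> (m <= scales n)%N -> (j <= (2 ^ m).+1)%N ->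
    (hits c (fun=> cell (2 ^ m) j)
       (index_iota (2 ^ a * n) (2 ^ a * n).*2) w)%:R <
      4 * M * (2 ^ a * n)%:R / (2 ^ m)%:R}.
Proof.
pose G n a m j : set T := [set w | 4 * M * (2 ^ a * n)%:R / (2 ^ m)%:R <=
  (hits c (fun=> cell (2 ^ m) j)
       (index_iota (2 ^ a * n) (2 ^ a * n).*2) w)%:R].
pose F n := \bigcup_(a in [set` iota 0 (scales n).+1])
  \bigcup_(m in [set` iota 0 (scales n).+1])
  \bigcup_(j in [set` iota 0 (2 ^ m).+2]) G n a m j.
have pos n a : (0 < n)%N -> (0 < 2 ^ a * n)%N by move=> n0; rewrite muln_gt0 expn_gt0.
have mG n a m j : (0 < n)%N -> measurable (G n a m j).
  move=> n0; apply: measurable_hits_ge => //.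
    by move=> _; exact: measurable_cell.
  by apply: all_pos_block; exact: pos.
have mF n : (0 < n)%N -> measurable (F n).
  by move=> n0; do 3!(apply: measurable_bigcup_seq => ? ?); exact: mG.
have PG n a m j : (0 < n)%N -> (m <= scales n)%N ->
    (P (G n a m j) <= (expR (- (2 ^ scales n)%:R))%:E)%E.
  move=> n0 mh; have K0 : (0 < 2 ^ m)%N by rewrite expn_gt0.
  have KR : 0 < (2 ^ m)%:R :> R by rewrite ltr0n.
  (* For a block of [N] points and [K = 2 ^ m], taking [t = 1] and four times the mean bound
     [M N / K] as threshold gives the exponent [M N / K - 2 M N / K = - M N / K]. Moreover [N / K >=
     n / 2 ^ scales n >= 2 ^ scales n]. *)
  apply: le_trans (@chernoff_hits _ _ _ P c (fun=> cell (2 ^ m) j)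
    (M / (2 ^ m)%:R) mc ind _ _ 1 _ _ ltr01 _ _) _ => //.
  - by move=> _; exact: measurable_cell.
  - by move=> k k0; exact: prob_cell_le.
  - exact: iota_uniq.
  - by apply: all_pos_block; exact: pos.
  rewrite lee_fin size_iota -addnn addnK ler_expR.
  rewrite [leLHS](_ : _ = - (M * (2 ^ a * n)%:R / (2 ^ m)%:R)); last first.
    by field; rewrite gt_eqF.
  rewrite lerN2 -mulrA; apply: (@le_trans _ _ ((2 ^ a * n)%:R / (2 ^ m)%:R)).
    2: by rewrite ler_peMl// divr_ge0.
  rewrite ler_pdivlMr// -natrM ler_nat.
  apply: (@leq_trans ((2 ^ scales n) ^ 2)).
    by rewrite leq_mul2l leq_exp2l// mh orbT.
  by rewrite (leq_trans (scales_le n0))// leq_pmull// expn_gt0.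
(* With [x = 2 ^ scales n] there are at most [3 x^3] triples [(a, m, j)], each of probability at
   most [exp (- x) <= 7! / x^7]. The resulting [x ^ -4] is at most [16 / n^2], as [n <= 4 x^2]. *)
have PF n : (0 < n)%N -> (P (F n) <= ((3 * 7`! * 16)%:R / n%:R ^+ 2)%:E)%E.
  move=> n0; set h := scales n; set b := expR (- (2 ^ h)%:R) : R.
  apply: (@le_trans _ _ ((size (iota 0 h.+1))%:R * ((size (iota 0 h.+1))%:R *
      ((2 ^ h).+2%:R * b)))%:E).
    apply: finite_union_bound => a _.
      by do 2!(apply: measurable_bigcup_seq => ? ?); exact: mG.
    apply: finite_union_bound => m; rewrite mem_iota add0n ltnS => /= mh.
      by apply: measurable_bigcup_seq => j _; exact: mG.
    apply: (@le_trans _ _ ((size (iota 0 (2 ^ m).+2))%:R * b)%:E).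
      by apply: finite_union_bound => j _; [exact: mG|exact: PG].
    by rewrite lee_fin size_iota ler_wpM2r ?expR_ge0// ler_nat !ltnS leq_exp2l.
  rewrite lee_fin !size_iota.
  pose x : R := (2 ^ h)%:R.
  have x1 : 1 <= x by rewrite ler1n expn_gt0.
  have x0 : 0 < x by exact: lt_le_trans x1.
  have hx : h.+1%:R <= x by rewrite ler_nat ltn_expl.
  have bx : b <= 7`!%:R / x ^+ 7 by exact: expRN_le.
  have nx : n%:R <= 4 * x ^+ 2 by rewrite -natrX -natrM ler_nat ltnW// lt_scales.
  have nR : 0 < n%:R :> R by rewrite ltr0n.
  apply: (@le_trans _ _ (x * (x * (3 * x * (7`!%:R / x ^+ 7))))).
    apply: ler_pM => //; first by rewrite !mulr_ge0// expR_ge0.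
    apply: ler_pM => //; first by rewrite !mulr_ge0// expR_ge0.
    apply: ler_pM => //; first by rewrite expR_ge0.
    by rewrite -natr1 -natr1 -/x; lra.
  rewrite [leLHS](_ : _ = (3 * 7`!)%:R / x ^+ 4); last first.
    by rewrite natrM; field; rewrite gt_eqF.
  rewrite ler_pdivrMr ?exprn_gt0// mulrAC ler_pdivlMr ?exprn_gt0//.
  rewrite [(_ * 16)%:R]natrM -[_ * 16%:R * _]mulrA ler_wpM2l//.
  rewrite (_ : 16%:R * x ^+ 4 = (4 * x ^+ 2) ^+ 2); last by ring.
  by rewrite lerXn2r// nnegrE ?mulr_ge0 ?exprn_ge0// ltW.
have := borel_cantelli_inv_sqr mF PF; apply: filterS => w [N FN].
exists N.+1 => n Nn a m j ah mh jm; rewrite ltNge; apply/negP => cij.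
apply: (FN n (ltnW Nn)).
have aK : a \in iota 0 (scales n).+1 by rewrite mem_iota.
have mK : m \in iota 0 (scales n).+1 by rewrite mem_iota.
have jK : j \in iota 0 (2 ^ m).+2 by rewrite mem_iota.
by exists a => //; exists m => //; exists j.
Qed.

End bounded_density.

(** * Deterministic passage from separation and cell counts to (A3) and (A2) *)

Section deterministic.
Context (R : realType).
Implicit Types (x : R) (c : nat -> R).

Lemma oppr_ln_le (t : nat) x : (2 ^ t)%:R^-1 <= x -> - ln x <= t%:R.
Proof.
move=> tx; have t0 : 0 < (2 ^ t)%:R :> R by rewrite ltr0n expn_gt0.
have x0 : 0 < x by apply: lt_le_trans tx; rewrite invr_gt0.
rewrite lerNl -ler_expR lnK ?posrE// (le_trans _ tx)//.
rewrite expRN lef_pV2 ?posrE ?expR_gt0// natrX -[t%:R]mulr1 expRM_natl.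
(* What remains is [2 <= exp 1]. *)
by rewrite lerXn2r ?nnegrE ?expR_ge0// (le_trans _ (expR_ge1Dx _)).
Qed.

(** A single term of the sum suffices. If [2 ^ -(m+1) <= x < 2 ^ -m], then [- ln x <= m + 1]; if [x]
    is below every scale up to [h], the assumed lower bound gives [- ln x <= 10 (h + 1)], the term
    of index [h]. *)
Lemma oppr_ln_dyadic (m0 h : nat) x : (m0 <= h)%N ->
  (2 ^ (10 * h.+1))%:R^-1 <= x -> x < (2 ^ m0)%:R^-1 ->
  - ln x <= \sum_(m0 <= m < h.+1) 10 * m.+1%:R * (x < (2 ^ m)%:R^-1)%R%:R.
Proof.
move=> m0h hx; rewrite -(subnK m0h); move: (h - m0)%N (subnK m0h) => k.
elim: k m0 {m0h} => [|k ih] m0 kh xm0.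
  rewrite add0n in kh *; rewrite big_nat1 xm0 mulr1 -natrM kh.
  exact: oppr_ln_le.
rewrite big_ltn ?ltnS ?leq_addl// xm0 mulr1.
have [x1|x1] := ltP x (2 ^ m0.+1)%:R^-1.
  have := ih m0.+1; rewrite addnS -addSn => /(_ kh x1) /le_trans; apply.
  by rewrite lerDr mulr_ge0.
rewrite (le_trans (oppr_ln_le x1))// ler_wpDr//.
  by apply: sumr_ge0 => m _; rewrite !mulr_ge0.
by rewrite ler_peMl// ler1n.
Qed.

(** The sum telescopes: [(m + 1) / 2^m = g m - g (m + 1)] with [g m = (2 m + 4) / 2^m]. *)
Lemma sum_dyadic_weights (m0 k : nat) :
  \sum_(m0 <= m < m0 + k) m.+1%:R / (2 ^ m)%:R <= (2 * m0 + 4)%:R / (2 ^ m0)%:R :> R.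
Proof.
suff -> : \sum_(m0 <= m < m0 + k) m.+1%:R / (2 ^ m)%:R =
   (2 * m0 + 4)%:R / (2 ^ m0)%:R - (2 * (m0 + k) + 4)%:R / (2 ^ (m0 + k))%:R :> R.
  by rewrite gerBl divr_ge0.
elim: k => [|k ih]; first by rewrite addn0 big_geq// subrr.
rewrite addnS big_nat_recr ?leq_addr//= ih expnS.
have : (2 ^ (m0 + k))%:R != 0 :> R by rewrite pnatr_eq0 expn_eq0.
rewrite !natrM !natrD !natrM -!natr1.
move: (2 ^ (m0 + k))%:R (2 ^ m0)%:R^-1 => y z y0; rewrite natrD; field.
exact: y0.
Qed.

Lemma linear_lt_pow2 (C : R) : 0 <= C -> exists m, C * (2 * m + 4)%:R < (2 ^ m)%:R.
Proof.
(* With [m = 2 k] the left side is [4 C (k + 1) < (k + 1)^2], and [k + 1 <= 2^k]. *)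
move=> C0; pose k := Num.truncn (4 * C); exists (2 * k)%N.
have := truncnS_gt (4 * C); rewrite -/k => kC.
have k0 : 0 < k.+1%:R :> R by [].
apply: (@lt_le_trans _ _ (k.+1%:R * k.+1%:R)).
  rewrite (_ : (2 * (2 * k) + 4)%N = (4 * k.+1)%N); last by lia.
  by rewrite natrM mulrA ltr_pM2r// mulrC.
by rewrite -natrM ler_nat mulnC expnM mulnn leq_exp2r// ltn_expl.
Qed.

(** All points counted lie in the three cells around that of [c i]. The last of them may have index
    [K + 1]. *)
Lemma near_count_le c (J : seq nat) (K i : nat) (B : R) : (0 < K)%N -> (0 < i)%N ->
  all (ltn 0) J -> (forall k, (0 < k)%N -> 0 <= c k <= 1) ->
  (forall b, (b <= K.+1)%N -> (count (fun k => c k \in cell K b) J)%:R <= B) ->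
  \sum_(j <- J) (`|c i - c j| < K%:R^-1)%R%:R <= 3 * B.
Proof.
move=> K0 i0 /allP J0 c01 cB; set a := Num.truncn (K%:R * c i).
have aK : (a <= K)%N by apply: trunc_le; exact: c01.
have countE b : (count (fun k => c k \in cell K b) J)%:R =
    \sum_(j <- J) (c j \in cell K b)%:R :> R.
  by rewrite -sum1_count big_mkcond natr_sum; apply: eq_bigr => j _; case: ifP.
apply: (@le_trans _ _ (\sum_(j <- J) ((c j \in cell K a.-1)%:R +
    (c j \in cell K a)%:R + (c j \in cell K a.+1)%:R))).
  rewrite !big_seq; apply: ler_sum => j /J0 j0.
  have [ij|] := ltP; last by rewrite !addr_ge0.
  have /andP[ci0 _] := c01 _ i0; have /andP[cj0 _] := c01 _ j0.
  have := trunc_near K0 ci0 cj0 ij; rewrite /= -/a.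
  have := cell_trunc K0 cj0; move: (Num.truncn _) => b /mem_set cjb.
  by rewrite !inE => /or3P[]/eqP <-; rewrite cjb ?lerDl ?lerDr ?addr_ge0//
    -?addrA ?lerDl ?addr_ge0// addrCA lerDl addr_ge0.
rewrite !big_split/= -!countE (_ : 3 * B = B + B + B); last by ring.
by rewrite !lerD// cB//; lia.
Qed.

(** All indices are at least [n], so the quotient is at most [exp (- lambda n) n^5]. The sixth-order
    term of the exponential series bounds this by [6! / (lambda^6 n)]. *)
Lemma separated_A3 c (lambda : R) : 0 < lambda ->
  (exists N, forall n, (N <= n)%N -> forall i j,
    (n <= i < 2 ^ (scales n).+1 * n)%N -> (n <= j < 2 ^ (scales n).+1 * n)%N ->
    i != j -> n%:R ^- 5 <= `|c i - c j|) ->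
  assumption_A3 c (fun k => expR (- (lambda * k%:R))) scales.
Proof.
move=> l0 [N sep] eps eps0.
pose C : R := 6`!%:R / lambda ^+ 6 / eps.
exists (maxn N (Num.truncn C).+1) => n; rewrite geq_max => /andP[Nn Cn] i j.
have range k : in_Anq n (scales n) k -> (n <= k < 2 ^ (scales n).+1 * n)%N.
  move=> [a [ah /andP[ak ka]]]; apply/andP; split.
    by apply: leq_trans ak; rewrite leq_pmull// expn_gt0.
  by apply: (leq_trans ka); rewrite leq_mul2r leq_exp2l// ltnS ah orbT.
move=> /range ri /range rj /eqP ij; have sij := sep _ Nn _ _ ri rj ij.
have n0 : 0 < n%:R :> R by rewrite ltr0n; lia.
have dij : 0 < `|c i - c j| by apply: lt_le_trans sij; rewrite invr_gt0 exprn_gt0.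
split; first by move=> cij; rewrite cij subrr normr0 ltxx in dij.
have lk k : (n <= k)%N -> expR (- (lambda * k%:R)) <= expR (- (lambda * n%:R)).
  by move=> nk; rewrite ler_expR lerN2 ler_pM2l// ler_nat.
apply: (@le_lt_trans _ _ (expR (- (lambda * n%:R)) * n%:R ^+ 5)).
  rewrite ler_pdivrMr ?mulr_gt0//.
  apply: (@le_trans _ _ (2 * expR (- (lambda * n%:R)))).
    by have := lk _ (andP ri).1; have := lk _ (andP rj).1; lra.
  have : 1 <= n%:R ^+ 5 * `|c i - c j| by rewrite -ler_pdivrMl ?exprn_gt0// mulr1.
  move: (expR_ge0 (- (lambda * n%:R))); move: (expR _) (`|_|) (_ ^+ 5) => e D X e0 XD.
  by have : 0 <= e * (X * D - 1); [rewrite mulr_ge0 ?subr_ge0|nra].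
apply: (@le_lt_trans _ _ (6`!%:R / (lambda * n%:R) ^+ 6 * n%:R ^+ 5)).
  by rewrite ler_wpM2r ?exprn_ge0//; exact: (expRN_le 5 (mulr_gt0 l0 n0)).
rewrite [ltLHS](_ : _ = C * eps / n%:R); last by rewrite /C; field; rewrite !gt_eqF.
rewrite ltr_pdivrMr// mulrC ltr_pM2l// (lt_le_trans (truncnS_gt C))// ler_nat//.
Qed.

End deterministic.

Lemma counts_A2 (R : realType) (c : nat -> R) (M : R) : 1 <= M ->
  (forall k, (0 < k)%N -> 0 <= c k <= 1) ->
  (exists N, forall n, (N <= n)%N -> forall i j,
    (n <= i < 2 ^ (scales n).+1 * n)%N -> (n <= j < 2 ^ (scales n).+1 * n)%N ->
    i != j -> n%:R ^- 5 <= `|c i - c j|) ->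
  (exists N, forall n, (N <= n)%N -> forall a m j,
    (a <= scales n)%N -> (m <= scales n)%N -> (j <= (2 ^ m).+1)%N ->
    (count (fun k => c k \in cell (2 ^ m) j)
       (index_iota (2 ^ a * n) (2 ^ a * n).*2))%:R <
      4 * M * (2 ^ a * n)%:R / (2 ^ m)%:R) ->
  assumption_A2 c scales.
Proof.
move=> M1 c01 [N1 sep] [N2 cnt] eps eps0.
have M0 : 0 <= M by exact: le_trans M1.
(* The constant is [120 = 10 * 3 * 4]: logarithmic weight, neighbouring cells, excess over the
   expected count. The scale [m0] makes the tail of the dyadic series small, and
   [delta = 2 ^ -m0]. *)
have [|m0 m0P] := @linear_lt_pow2 R (120 * M / eps).
  by rewrite divr_ge0 ?mulr_ge0// ltW.
have [N3 N3P] := scales_unbounded m0.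
have pow0 m : 0 < (2 ^ m)%:R :> R by rewrite ltr0n expn_gt0.
exists (2 ^ m0)%:R^-1; first by rewrite invr_gt0.
exists (maxn 1 (maxn N1 (maxn N2 N3))) => n.
rewrite !geq_max => /and4P[n0 n1 n2 /N3P m0h] a b ah bh /=.
set n' := (2 ^ a * n)%N; set n'' := (2 ^ b * n)%N.
have posn' : (0 < n')%N by rewrite muln_gt0 expn_gt0.
have posn'' : (0 < n'')%N by rewrite muln_gt0 expn_gt0.
have block e k : (e <= scales n)%N -> (2 ^ e * n <= k < (2 ^ e * n).*2)%N ->
    (n <= k < 2 ^ (scales n).+1 * n)%N.
  move=> eh /andP[ek ke]; apply/andP; split.
    by apply: leq_trans ek; rewrite leq_pmull// expn_gt0.
  apply: (leq_trans ke); rewrite -mul2n mulnA -expnS leq_mul2r.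
  by rewrite leq_exp2l// ltnS eh orbT.
have near_le m i : (m <= scales n)%N -> (0 < i)%N ->
    \sum_(n'' <= j < n''.*2) (`|c i - c j| < (2 ^ m)%:R^-1)%R%:R <=
    3 * (4 * M * n''%:R / (2 ^ m)%:R).
  move=> mh i0; apply: near_count_le => //.
  - by rewrite expn_gt0.
  - exact: all_pos_block.
  - by move=> j jm; apply/ltW; exact: cnt.
(* Its fifth power turns the separation [n ^ -5] into the lower bound [2 ^ -(10 (scales n + 1))] of
   [oppr_ln_dyadic]. *)
have n_le : (n <= 2 ^ (2 * (scales n).+1))%N.
  by rewrite mulnC expnM (expnS 2) expnMn ltnW// lt_scales.
apply: (@le_lt_trans _ _ ((n' * n'')%:R^-1 *
  \sum_(n' <= i < n'.*2) \sum_(n'' <= j < n''.*2)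
    \sum_(m0 <= m < (scales n).+1) 10 * m.+1%:R *
       (`|c i - c j| < (2 ^ m)%:R^-1)%R%:R)).
  rewrite ler_wpM2l// ?invr_ge0// big_nat [leRHS]big_nat; apply: ler_sum => i ii.
  rewrite big_mkcond/= big_nat [leRHS]big_nat; apply: ler_sum => j jj.
  case: ifPn => [/andP[ij cij]|_]; last by apply: sumr_ge0 => m _; rewrite !mulr_ge0.
  apply: oppr_ln_dyadic => //.
  apply: le_trans _ (sep _ n1 _ _ (block _ _ ah ii) (block _ _ bh jj) ij).
  rewrite -natrX lef_pV2 ?posrE ?ltr0n ?expn_gt0 ?n0// ler_nat.
  apply: (@leq_trans ((2 ^ (2 * (scales n).+1)) ^ 5)); first by rewrite leq_exp2r.
  by rewrite -expnM leq_exp2l//; lia.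
apply: (@le_lt_trans _ _ (120 * M * \sum_(m0 <= m < (scales n).+1) m.+1%:R / (2 ^ m)%:R)).
  rewrite ler_pdivrMl; last by rewrite ltr0n muln_gt0 posn'.
  (* The sum over scales is taken outside, so that for fixed [m] and [i] the inner sum counts the
     points near [c i]. *)
  under eq_bigr do rewrite exchange_big/=.
  rewrite exchange_big/= !mulr_sumr big_nat [leRHS]big_nat.
  apply: ler_sum => m /andP[_ mh].
  rewrite [leRHS](_ : _ = \sum_(n' <= i < n'.*2)
     10 * m.+1%:R * (3 * (4 * M * n''%:R / (2 ^ m)%:R))); last first.
    rewrite big_const_nat -addnn addnK iter_addr_0 -[RHS]mulr_natr natrM.
    by field; rewrite gt_eqF.
  rewrite big_nat [leRHS]big_nat; apply: ler_sum => i /andP[ni _].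
  rewrite -mulr_sumr ler_wpM2l ?mulr_ge0// near_le//.
  exact: leq_trans ni.
rewrite -(subnKC (leqW m0h)).
apply: (@le_lt_trans _ _ (120 * M * ((2 * m0 + 4)%:R / (2 ^ m0)%:R))).
  by rewrite ler_wpM2l ?mulr_ge0// sum_dyadic_weights.
rewrite mulrA ltr_pdivrMr// [eps * _]mulrC -ltr_pdivrMr//.
by rewrite [ltLHS]mulrAC.
Qed.

(** * Step-function approximation and (A1) *)

Section riemann_sums.
Context (R : realType) (phi : R -> R).
Notation mu := (@lebesgue_measure R).
Notation I01 := (`[0%R, 1%R]%classic : set R).

(** Compactness of the segment in its near-covering form. Around each point, half of a continuity
    radius serves for the neighbourhood and half for the mesh; the modulus is some [1 / K] to fit
    the grid. *)
Lemma unif_continuous_I01 (f : R -> R) (e : R) : {within I01, continuous f} ->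
  0 < e -> exists2 K, (0 < K)%N & forall x y, I01 x -> I01 y ->
    `|x - y| < K%:R^-1 -> `|f x - f y| < e.
Proof.
move=> /subspace_continuousP fc e0.
have /compact_near_coveringP/near_covering_withinP := @segment_compact R 0 1.
move=> /(_ nat \oo (fun i x => forall y, I01 y -> `|x - y| < i.+1%:R^-1 ->
  `|f x - f y| < e)) cov.
suff pt (x : R) : I01 x -> \forall x' \near x & i \near \oo, I01 x' ->
    forall y, I01 y -> `|x' - y| < i.+1%:R^-1 -> `|f x' - f y| < e.
  have [N _ HN] := cov _ pt.
  by exists N.+1 => // x y xI yI xy; exact: (HN N (leqnn N) x xI).
move=> xI; have /cvgrPdist_lt/(_ (e / 2)) := fc x xI.
rewrite divr_gt0// => /(_ isT); rewrite near_withinE => /nbhs_ballP[r /= r0 xr].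
have {}xr (t : R) : `|x - t| < r -> I01 t -> `|f x - f t| < e / 2 by exact: xr.
have r20 : 0 < r / 2 by rewrite divr_gt0.
near=> z i => /= zI y yI zy.
have zx : `|x - z| < r / 2 by near: z; exact: nbhsx_ballx.
have ir : i.+1%:R^-1 < r / 2.
  near: i; exists (Num.truncn (r / 2)^-1) => // i /= ri.
  by rewrite invf_plt ?posrE// (lt_le_trans (truncnS_gt _))// ler_nat ltnS.
have fz : `|f x - f z| < e / 2 by apply: xr => //; lra.
have fy : `|f x - f y| < e / 2.
  apply: xr => //; rewrite -(subrKA z).
  by rewrite (le_lt_trans (ler_normD _ _))// (splitr r) ltrD// (lt_trans zy).
rewrite -(subrKA (f x)) (le_lt_trans (ler_normD _ _))// [`|f z - _|]distrC.
by rewrite (splitr e) ltrD.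
Unshelve. all: by end_near. Qed.

Lemma Rintegral_sum (D : set R) (I : Type) (s : seq I) (h : I -> R -> R) :
  measurable D -> (forall i, mu.-integrable D (EFin \o h i)) ->
  Rintegral mu D (fun x => \sum_(i <- s) h i x) = \sum_(i <- s) Rintegral mu D (h i).
Proof.
move=> mD ih; elim: s => [|i s IH].
  rewrite big_nil; under eq_Rintegral do rewrite big_nil.
  by rewrite Rintegral_cst// mul0r.
under eq_Rintegral do rewrite big_cons.
rewrite big_cons -IH RintegralD//.
rewrite (_ : EFin \o _ = fun x => (\sum_(i <- s) (EFin \o h i) x)%E).
  by apply: integrable_sum => // j _; exact: ih.
by apply/funext => x /=; rewrite -sumEFin.
Qed.

(** The sum is the integral against [phi] of the step function equal to [f (j / K)] on cell [j]. It
    is within [e] of [f] pointwise, and [phi] has total mass 1. *)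
Lemma Rintegral_step_le (f : R -> R) (e : R) (K : nat) : (0 < K)%N ->
  mu.-integrable I01 (EFin \o phi) -> (forall x, I01 x -> 0 <= phi x) ->
  Rintegral mu I01 phi = 1 -> {within I01, continuous f} ->
  (forall x y, I01 x -> I01 y -> `|x - y| < K%:R^-1 -> `|f x - f y| < e) ->
  `|Rintegral mu I01 (fun x => f x * phi x) -
    \sum_(j <- iota 0 K.+1) f (j%:R / K%:R) * Rintegral mu (cell K j `&` I01) phi| <= e.
Proof.
move=> K0 iphi phi0 phi1 fc fe.
have mI : measurable I01 by exact: measurable_itv.
have KR : 0 < K%:R :> R by rewrite ltr0n.
have ifphi : mu.-integrable I01 (EFin \o (fun x => f x * phi x)).
  rewrite (_ : EFin \o _ = ((EFin \o f) \* (EFin \o phi))%E)//.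
  apply: (@integrableMr _ _ _ mu I01 mI f _ _ _ iphi).
    by apply: subspace_continuous_measurable_fun.
  have : bounded_set (f @` I01).
    apply: compact_bounded; apply: continuous_compact => //.
    exact: segment_compact.
  move=> [B [Br HB]]; exists B; split => // x Bx y yI /=.
  by apply: (HB x Bx); exists y.
have icell j : mu.-integrable I01 (EFin \o (phi \_ (cell K j))).
  rewrite -restrict_EFin; apply/integrable_restrict => //.
    exact: measurable_cell.
  by apply: integrableS iphi => //; apply: measurableI => //; exact: measurable_cell.
(* Restricting [phi] by zero puts all cell integrals on the same domain, where they can be added. *)
pose h (j : nat) (x : R) : R := f (j%:R / K%:R) * (phi \_ (cell K j)) x.
have ih j : mu.-integrable I01 (EFin \o h j).
  rewrite (_ : EFin \o _ = fun x =>
    ((f (j%:R / K%:R))%:E * (EFin \o (phi \_ (cell K j))) x)%E)//.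
  exact: integrableZl.
have isum : mu.-integrable I01 (EFin \o (fun x => \sum_(j <- iota 0 K.+1) h j x)).
  rewrite (_ : EFin \o _ = fun x => (\sum_(j <- iota 0 K.+1) (EFin \o h j) x)%E).
    by apply: integrable_sum => // i _; exact: ih.
  by apply/funext => x /=; rewrite -sumEFin.
under eq_bigr do rewrite Rintegral_mkcondl -RintegralZl//.
rewrite -(Rintegral_sum _ mI ih) -RintegralB//.
have step x : I01 x -> \sum_(j <- iota 0 K.+1) h j x =
    f ((Num.truncn (K%:R * x))%:R / K%:R) * phi x.
  rewrite /= in_itv/= => xI; have /andP[x0 x1] := xI.
  have xK : Num.truncn (K%:R * x) \in iota 0 K.+1.
    by rewrite mem_iota add0n ltnS trunc_le.
  rewrite /h (bigD1_seq _ xK (iota_uniq _ _))/=.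
  rewrite patchE mem_set ?big1 ?addr0//; last exact: cell_trunc.
  move=> j; rewrite patchE; case: ifPn; last by rewrite mulr0.
  by move=> /set_mem/(trunc_cell K0) ->; rewrite eqxx.
have near_step x : I01 x ->
    `|f x * phi x - f ((Num.truncn (K%:R * x))%:R / K%:R) * phi x| <= e * phi x.
  move=> xI; rewrite -mulrBl normrM [X in _ * X]ger0_norm ?phi0//.
  rewrite ler_wpM2r ?phi0//; apply/ltW/fe => //.
    move: xI; rewrite /= !in_itv/= => xI.
    by rewrite divr_ge0// ler_pdivrMr// mul1r ler_nat trunc_le.
  move: xI; rewrite /= in_itv/= => /andP[x0 x1].
  have := cell_trunc K0 x0; rewrite /cell/= in_itv/= -natr1 mulrDl mul1r.
  by move=> /andP[h1 h2]; rewrite ger0_norm ?subr_ge0// ltrBlDl.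
have idiff : mu.-integrable I01
    (EFin \o (fun x => f x * phi x - \sum_(j <- iota 0 K.+1) h j x)).
  rewrite (_ : EFin \o _ = ((EFin \o (fun x => (f x * phi x)%R)) \-
    (EFin \o (fun x => (\sum_(j <- iota 0 K.+1) h j x)%R)))%E)//.
  exact: integrableB.
apply: (le_trans (le_normr_Rintegral _ idiff)) => //.
have <- : Rintegral mu I01 (fun x => e * phi x) = e.
  by rewrite RintegralZl// phi1 mulr1.
apply: le_Rintegral => //.
- exact: (integrable_norm idiff).
- rewrite (_ : EFin \o _ = fun x => (e%:E * (EFin \o phi) x)%E)//.
  exact: integrableZl.
- by move=> x xI; rewrite step// near_step.
Qed.

(** Three errors of size [e / 3]: from the integral to its step version, from cell masses to cell
    frequencies, and from the step function to [f] in the empirical mean. *)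
Lemma cells_A1 (c : nat -> R) :
  mu.-integrable I01 (EFin \o phi) -> (forall x, I01 x -> 0 <= phi x) ->
  Rintegral mu I01 phi = 1 ->
  {ae mu, forall x, I01 x -> 0 < phi x} ->
  (forall k, (0 < k)%N -> 0 <= c k <= 1) ->
  (forall K j : nat,
    (count (fun k => c k \in cell K j) (index_iota n n.*2))%:R / n%:R @[n --> \oo]
      --> Rintegral mu (cell K j `&` I01) phi) ->
  assumption_A1 c.
Proof.
move=> iphi phi0 phi1 phi_gt0 c01 freq; exists phi; split => //; split => // f fc.
apply/cvgrPdist_lt => e e0; have e30 : 0 < e / 3 by rewrite divr_gt0.
have [K K0 fK] := unif_continuous_I01 fc e30.
have KR : 0 < K%:R :> R by rewrite ltr0n.
pose a (j : nat) : R := f (j%:R / K%:R).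
pose fr (n j : nat) : R :=
  (count (fun k => c k \in cell K j) (index_iota n n.*2))%:R / n%:R.
have : \sum_(j <- iota 0 K.+1) a j * fr n j @[n --> \oo] -->
    \sum_(j <- iota 0 K.+1) a j * Rintegral mu (cell K j `&` I01) phi.
  apply: cvg_big => [|j _]; first exact: add_continuous.
  by apply: cvgM; [exact: cvg_cst|exact: freq].
move=> /cvgrPdist_lt/(_ _ e30) fr_near.
near=> n; have n0 : (0 < n)%N by near: n; exists 1%N.
have nR : 0 < n%:R :> R by rewrite ltr0n.
have h1 := Rintegral_step_le K0 iphi phi0 phi1 fc fK.
have h2 : `|\sum_(j <- iota 0 K.+1) a j * Rintegral mu (cell K j `&` I01) phi -
    \sum_(j <- iota 0 K.+1) a j * fr n j| < e / 3 by near: n.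
have h3 : `|\sum_(j <- iota 0 K.+1) a j * fr n j -
    n%:R^-1 * \sum_(n <= k < n.*2) f (c k)| <= e / 3.
  rewrite [X in `|X - _|](_ : _ = n%:R^-1 *
      \sum_(n <= k < n.*2) a (Num.truncn (K%:R * c k))); last first.
    have -> : \sum_(n <= k < n.*2) a (Num.truncn (K%:R * c k)) =
        \sum_(n <= k < n.*2) \sum_(j <- iota 0 K.+1) a j * (c k \in cell K j)%:R.
      rewrite !big_seq; apply: eq_bigr => k; rewrite mem_index_iota => /andP[nk _].
      have k0 : (0 < k)%N by exact: leq_trans nk.
      have /andP[ck0 ck1] := c01 _ k0.
      have ckK : Num.truncn (K%:R * c k) \in iota 0 K.+1.
        by rewrite mem_iota add0n ltnS trunc_le// c01.
      rewrite (bigD1_seq _ ckK (iota_uniq _ _))/=.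
      rewrite mem_set ?mulr1 ?big1 ?addr0//; last exact: cell_trunc.
      move=> j jk; case: (boolP (c k \in cell K j)); last by rewrite mulr0.
      by move=> /set_mem/(trunc_cell K0) kj; rewrite kj eqxx in jk.
    rewrite exchange_big/= mulr_sumr; apply: eq_bigr => j _.
    rewrite /fr -mulr_sumr [RHS]mulrCA; congr (_ * _).
    by rewrite mulrC -sum1_count big_mkcond natr_sum; congr (_ * _);
      apply: eq_bigr => k _; case: ifP.
  rewrite -mulrBr -sumrB normrM ger0_norm ?invr_ge0// ler_pdivrMl//.
  apply: (le_trans (ler_norm_sum _ _ _)).
  apply: (@le_trans _ _ (\sum_(n <= k < n.*2) (e / 3))).
    rewrite !big_seq; apply: ler_sum => k; rewrite mem_index_iota => /andP[nk _].
    have k0 : (0 < k)%N by exact: leq_trans nk.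
    have ck := c01 _ k0; have /andP[ck0 ck1] := ck.
    apply/ltW/fK; rewrite /= ?in_itv//=.
      by rewrite divr_ge0// ler_pdivrMr// mul1r ler_nat trunc_le.
    have := cell_trunc K0 ck0; rewrite /cell/= in_itv/= -natr1 mulrDl mul1r.
    by move=> /andP[u1 u2]; rewrite distrC ger0_norm ?subr_ge0// ltrBlDl.
  by rewrite big_const_nat -addnn addnK iter_addr_0 -[leLHS]mulr_natl.
move: h1 h2 h3; set I := Rintegral _ _ _; set S := \sum_(j <- _) _ * Rintegral _ _ _.
set A := \sum_(j <- _) _; set B := n%:R^-1 * _ => h1 h2 h3.
rewrite -(subrKA S) (le_lt_trans (ler_normD _ _))//.
have : `|S - B| <= `|S - A| + `|A - B| by rewrite -(subrKA A) ler_normD.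
lra.
Unshelve. all: by end_near. Qed.

End riemann_sums.

(** * Intersection of the almost sure events *)

Theorem theorem1p9 (R : realType) (lambda : R) (d : measure_display)
    (T : measurableType d) (P : probability T R) (c : nat -> T -> R)
    (phi : R -> R) :
  0 < lambda ->
  (* each c_k (k >= 1) is a real random variable *)
  (forall k, (0 < k)%N -> measurable_fun setT (c k)) ->
  (* independence of (c_k)_{k >= 1} *)
  mutually_independent_rv P [set k | (0 < k)%N] c ->
  (* common distribution, absolutely continuous on [0,1] with density phi *)
  (forall k, (0 < k)%N -> forall A : set R, measurable A ->
     P (c k @^-1` A) =
       (\int[lebesgue_measure]_(x in A `&` (`[0%R, 1%R]%classic : set R)) (phi x)%:E)%E) ->
  measurable_fun (`[0%R, 1%R]%classic : set R) phi ->
  (* uniformly bounded density *)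
  (exists M : R, forall x, (`[0%R, 1%R]%classic : set R) x -> 0 <= phi x <= M) ->
  (* almost everywhere positive density *)
  {ae lebesgue_measure, forall x, (`[0%R, 1%R]%classic : set R) x -> 0 < phi x} ->
  {ae P, forall w, assumptions_A123 (fun k => c k w)
                     (fun k => expR (- (lambda * k%:R)))}.
Proof.
move=> lambda0 mc ind dens mphi [B phiB] phi_gt0.
set I01 := (`[0%R, 1%R]%classic : set R) in dens mphi phiB phi_gt0.
have mI : measurable I01 by exact: measurable_itv.
(* A bound at least 1 gives [M N / K >= N / K] in the Chernoff exponent of [ae_cell_counts]. *)
pose M := Num.max B 1; have M1 : 1 <= M by rewrite le_max lexx orbT.
have phi0 x : I01 x -> 0 <= phi x by move=> /phiB/andP[].
have phiM x : I01 x -> phi x <= M by move=> /phiB/andP[_ h]; rewrite le_max h.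
have iphi : lebesgue_measure.-integrable I01 (EFin \o phi).
  apply: measurable_bounded_integrable => //.
    by rewrite [ltLHS](lebesgue_measure_itv `[0, 1])/= lte_fin ltr01 -EFinB ltry.
  exists M; split; first exact: num_real.
  by move=> y My x xI; rewrite /= ger0_norm ?phi0// (le_trans (phiM _ xI))// ltW.
have iphiA A : measurable A -> lebesgue_measure.-integrable (A `&` I01) (EFin \o phi).
  by move=> mA; apply: integrableS iphi => //; exact: measurableI.
have densR A k : (0 < k)%N -> measurable A ->
    P (c k @^-1` A) = (Rintegral lebesgue_measure (A `&` I01) phi)%:E.
  move=> k0 mA; rewrite dens// /Rintegral fineK//.
  by apply: integrable_fin_num; [exact: measurableI|exact: iphiA].
have phi1 : Rintegral lebesgue_measure I01 phi = 1.
  have := densR setT 1%N isT measurableT.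
  by rewrite preimage_setT setTI probability_setT => -[].
have cM k : (0 < k)%N -> forall A : set R, measurable A ->
    (P (c k @^-1` A) <= M%:E * lebesgue_measure A)%E.
  move=> k0 A mA; rewrite dens//.
  apply: (@le_trans _ _ (\int[lebesgue_measure]_(x in A `&` I01) (cst M%:E) x)%E).
    apply: ge0_le_integral => //.
    - exact: measurableI.
    - by move=> x [_ xI]; rewrite lee_fin phi0.
    - by have /integrableP[] := iphiA A mA.
    - by move=> x [_ xI]; rewrite lee_fin phiM.
  rewrite integral_cst; last exact: measurableI.
  rewrite lee_wpmul2l ?lee_fin ?(le_trans _ M1)//.
  by apply: le_measure; rewrite ?inE//; exact: measurableI.
have c01 : {ae P, forall w, forall k, (0 < k)%N -> 0 <= c k w <= 1}.
  apply: ae_foralln => k; have [k0|k0] := posnP k; first by apply: aeW => w; rewrite k0.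
  (* The law of [c k] is an integral over [A] intersected with [[0,1]], so it gives the complement
     of [[0,1]] mass zero. *)
  exists (c k @^-1` (~` I01)); split.
  - by rewrite -[X in measurable X]setTI; apply: mc => //; exact: measurableC.
  - by rewrite [LHS](dens k k0 _ (measurableC mI)) setICl integral_set0.
  - move=> w /= H; apply: contra_not H => ckw _.
    by move: ckw; rewrite /I01/= in_itv.
have freq : {ae P, forall w, forall K j : nat,
    (hits c (fun=> cell K j) (index_iota n n.*2) w)%:R / n%:R @[n --> \oo]
      --> Rintegral lebesgue_measure (cell K j `&` I01) phi}.
  (* There are countably many cells, so one null set serves for all of them, and thus for every
     continuous [f]. *)
  apply: ae_foralln => K; apply: ae_foralln => j.
  have mK : measurable (cell K j : set R) by exact: measurable_cell.
  by apply: ae_block_frequency_cvg => // k k0; exact: densR.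
have sep := ae_separated mc ind M1 cM c01.
have cnt := ae_cell_counts mc ind M1 cM.
near=> w.
have w01 : forall k, (0 < k)%N -> 0 <= c k w <= 1 by near: w.
split; first by apply: (cells_A1 iphi phi0 phi1 phi_gt0 w01); near: w.
exists scales; split; first exact: scales_unbounded.
split; first by apply: (counts_A2 M1 w01); near: w.
by apply: separated_A3 => //; near: w.
Unshelve. all: by end_near. Qed.
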